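(* Let $G$ be a graph constructed, together with a coloring of its vertices, by the following procedure: (1) Construct an odd cycle and color its vertices blue. (2) Either perform step (3), or perform step (4), or stop. (3) Choose any existing vertex $u$, add two new vertices $u_1,u_2$ and edges $uu_1, u_1u_2$; color $u_1$ red and $u_2$ black; go to (2). (4) If there is no red vertex go to (2); otherwise choose a red vertex $u$, add a new vertex $u_1$ and the edge $uu_1$, color $u_1$ black; go to (2). Then every maximum matching of $G$ covers all the red vertices of $G$.
   Context: All graphs are finite and simple. A maximum matching is a matching of largest possible size; it covers a vertex if the vertex is an endpoint of one of its edges. *)

(* Defs.v *)
From mathcomp Require Import all_boot.

Set Implicit Arguments.
Unset Strict Implicit.
Unset Printing Implicit Defensive.

Record sgraph := SGraph {
  vertex :> finType;
  adj : rel vertex;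
  adj_sym : symmetric adj;
  adj_irrefl : irreflexive adj }.

Definition edges (G : sgraph) : {set {set G}} :=
  [set [set x; y] | x in vertex G, y in vertex G & adj x y].

Definition is_matching (G : sgraph) (M : {set {set G}}) : Prop :=
  M \subset edges G /\ trivIset M.

Definition maximum_matching (G : sgraph) (M : {set {set G}}) : Prop :=
  is_matching M /\ (forall N : {set {set G}}, is_matching N -> #|N| <= #|M|).

Definition covers (G : sgraph) (M : {set {set G}}) (v : G) : Prop :=
  exists2 e : {set G}, e \in M & v \in e.

Inductive color := Blue | Red | Black.

Record cgraph := CGraph {
  cgraph_graph :> sgraph;
  coloring : cgraph_graph -> color }.

Definition cgraph_iso (G H : cgraph) : Prop :=
  exists f : G -> H,
    [/\ bijective f,
        forall x y : G, adj (f x) (f y) = adj x y &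
        forall x : G, coloring (f x) = coloring x].

Section Cycle.
Variable k : nat.

Definition cycle_adj : rel 'I_(k.*2.+3) :=
  fun i j => (j == ordS i) || (i == ordS j).

Lemma cycle_adj_sym : symmetric cycle_adj.
Proof. by move=> i j; rewrite /cycle_adj orbC. Qed.

Lemma cycle_adj_irrefl : irreflexive cycle_adj.
Proof.
move=> i; rewrite /cycle_adj orbb; apply/negbTE/eqP => /(congr1 val) /=.
have := ltn_ord i; rewrite ltnS leq_eqVlt => /orP[/eqP ->|lt_i].
  by rewrite modnn.
by rewrite modn_small ?ltnS // => /eqP; rewrite ltn_eqF.
Qed.

(* The cycle of length 2k + 3, so k ranges over all odd lengths >= 3. *)
Definition odd_cycle : sgraph := SGraph cycle_adj_sym cycle_adj_irrefl.

End Cycle.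

Section AddLeaf.
Variables (G : sgraph) (u : G).

Definition leaf_adj : rel (option G) := fun x y =>
  match x, y with
  | Some a, Some b => adj a b
  | Some a, None | None, Some a => a == u
  | None, None => false
  end.

Lemma leaf_adj_sym : symmetric leaf_adj.
Proof. by case=> [x|] [y|] //=; apply: adj_sym. Qed.

Lemma leaf_adj_irrefl : irreflexive leaf_adj.
Proof. by case=> [x|] //=; apply: adj_irrefl. Qed.

(* The new vertex is [None], and its only neighbour is [Some u]. *)
Definition add_leaf : sgraph := SGraph leaf_adj_sym leaf_adj_irrefl.

End AddLeaf.

Definition add_colored_leaf (G : cgraph) (u : G) (c : color) : cgraph :=
  @CGraph (add_leaf u) (fun x => if x is Some v then coloring v else c).

(* [None] in [build_path] is the vertex u1 just added.  The last constructor
   makes the identity of the vertices irrelevant. *)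
Inductive constructed : cgraph -> Prop :=
| build_cycle (k : nat) :
    constructed (@CGraph (odd_cycle k) (fun=> Blue))
| build_path (G : cgraph) (u : G) :
    constructed G ->
    constructed
      (@add_colored_leaf (add_colored_leaf u Red) None Black)
| build_leaf (G : cgraph) (u : G) :
    constructed G -> coloring u = Red ->
    constructed (add_colored_leaf u Black)
| build_iso (G H : cgraph) :
    constructed G -> cgraph_iso G H -> constructed H.

(* Main.v *)
(**
Let r be the number of red vertices and 2b+1 the length of the blue cycle.
Black vertices have only red neighbours, so an edge without red endpoint joins
two blue vertices, and a matching has at most b of these; its other edges
number at most the red vertices it covers.  A matching missing a red vertex
thus has size at most b + r - 1, whereas b edges of the cycle together with
the edge u1u2 of each step (3) form a matching of size b + r.
*)
Require Import Defs.
From mathcomp Require Import all_boot.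

Set Implicit Arguments.
Unset Strict Implicit.
Unset Printing Implicit Defensive.

Lemma card_option_pred (T : finType) (p : pred (option T)) :
  #|[set x | p x]| = p None + #|[set x | p (Some x)]|.
Proof.
rewrite !cardsE !cardE /enum_mem !size_filter [in LHS]unlock /= count_map.
by congr (_ + _); apply: eq_count.
Qed.

(** Picking in each block an element of [A] is injective, since distinct blocks are disjoint. This
    later counts matching edges by their red endpoints. *)
Lemma leq_card_trivIset_meet (T : finType) (P : {set {set T}}) (A : {set T}) :
  trivIset P -> (forall e, e \in P -> exists2 x, x \in e & x \in A) -> #|P| <= #|A|.
Proof.
move=> /trivIsetP tP meetP; pose f (e : {set T}) := [pick x in e :&: A].
have fP e : e \in P -> exists x, [/\ f e = Some x, x \in e & x \in A].
  move=> /meetP[x xe xA]; rewrite /f; case: pickP => [y|/(_ x)].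
    by rewrite inE => /andP[ye yA]; exists y.
  by rewrite inE xe xA.
have f_inj : {in P &, injective f}.
  move=> e1 e2 e1P e2P.
  have [x [-> xe1 _]] := fP _ e1P; have [y [-> ye2 _]] := fP _ e2P.
  case=> eq_xy; apply/eqP; case: eqVneq => // /(tP _ _ e1P e2P).
  by move=> /disjointFr/(_ xe1); rewrite eq_xy ye2.
rewrite -(card_in_imset f_inj) -(card_imset (mem A) (@Some_inj _)).
apply/subset_leq_card/subsetP => _ /imsetP[e /fP[x [-> _ xA]] ->].
exact: imset_f.
Qed.

Lemma edgesP (G : sgraph) (e : {set G}) :
  reflect (exists x y, adj x y /\ e = [set x; y]) (e \in edges G).
Proof.
apply: (iffP imset2P) => [[x y _ /[!inE] xy ->]|[x [y [xy ->]]]].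
  by exists x, y; move: xy => /andP[].
by exists x y; rewrite ?inE.
Qed.

Lemma adj_neq (G : sgraph) (x y : G) : adj x y -> x != y.
Proof. by apply: contraTneq => ->; rewrite adj_irrefl. Qed.

Lemma is_matching0 (G : sgraph) : is_matching (set0 : {set {set G}}).
Proof.
by split; [exact: sub0set | apply/trivIsetP => ? ?; rewrite inE].
Qed.

(** As neither endpoint is covered, the new edge is disjoint from all the old ones, hence also
    different from them. *)
Lemma matching_add_edge (G : sgraph) (N : {set {set G}}) (x y : G) :
    is_matching N -> adj x y -> x \notin cover N -> y \notin cover N ->
  is_matching ([set x; y] |: N) /\ #|[set x; y] |: N| = #|N|.+1.
Proof.
move=> [sN tN] xy xN yN; have disj e : e \in N -> [disjoint [set x; y] & e].
  move=> eN; rewrite disjoints_subset; apply/subsetP => z.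
  rewrite !inE => zxy; apply/negP => ze.
  have zN : z \in cover N by apply/bigcupP; exists e.
  by case/orP: zxy => /eqP zE; move: zN; rewrite zE; apply/negP.
have xyN : [set x; y] \notin N.
  apply/negP => eN; case/negP: xN; apply/bigcupP; exists [set x; y] => //.
  by rewrite !inE eqxx.
rewrite cardsU1 xyN; split=> //; split.
  by rewrite subUset sub1set sN andbT; apply/edgesP; exists x, y.
move/trivIsetP: tN => tN; apply/trivIsetP => e1 e2 /setU1P[->|e1N] /setU1P[->|e2N].
- by rewrite eqxx.
- by move=> _; apply: disj.
- by move=> _; rewrite disjoint_sym; apply: disj.
- exact: tN.
Qed.

Definition image_matching (G H : finType) (f : G -> H) (N : {set {set G}}) :=
  [set f @: (e : {set G}) | e in N].

(** Serves both for the embedding of a graph into its extension by new vertices and for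
    isomorphisms. *)
Lemma is_matching_image (G H : sgraph) (f : G -> H) (N : {set {set G}}) :
    injective f -> (forall x y, adj x y -> adj (f x) (f y)) ->
  is_matching N -> is_matching (image_matching f N).
Proof.
move=> f_inj f_adj [/subsetP sN /trivIsetP tN]; split.
  apply/subsetP => _ /imsetP[e /sN/edgesP[x [y [xy ->]]] ->].
  by apply/edgesP; exists (f x), (f y); rewrite imsetU1 imset_set1; split; auto.
apply/trivIsetP => _ _ /imsetP[e1 e1N ->] /imsetP[e2 e2N ->].
by rewrite (inj_eq (imset_inj f_inj)) imset_disjoint //; apply: tN.
Qed.

Lemma card_image_matching (G H : finType) (f : G -> H) (N : {set {set G}}) :
  injective f -> #|image_matching f N| = #|N|.
Proof. by move=> f_inj; rewrite card_imset //; apply: imset_inj. Qed.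

Lemma cover_image_matching (G H : finType) (f : G -> H) (N : {set {set G}}) y :
  y \in cover (image_matching f N) -> exists x, y = f x.
Proof. by case/bigcupP => _ /imsetP[e _ ->] /imsetP[x _ ->]; exists x. Qed.

Lemma odd_cycle_matching k :
  exists2 N : {set {set odd_cycle k}}, is_matching N & #|N| = k.+1.
Proof.
(* Take the edges {2i, 2i+1} for i < j. Tracking that only vertices below 2j are covered keeps both
   ends of the next edge free. *)
suff /(_ k.+1 (leqnn _)) [N [Nm Nc _]] : forall j, j <= k.+1 ->
    exists N : {set {set odd_cycle k}}, [/\ is_matching N, #|N| = j &
      forall i : 'I_k.*2.+3, i \in cover N -> i < j.*2].
  by exists N.
elim=> [_|j IHj lt_jk].
  exists set0; split; rewrite ?cards0 //; first exact: is_matching0.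
  by move=> i; rewrite /cover big_set0 inE.
have [N [Nm Nc Ncov]] := IHj (ltnW lt_jk).
have lt_x : j.*2 < k.*2.+3 by rewrite -[k.*2.+2]/(k.+1.*2) ltnS leq_double ltnW.
have lt_y : j.*2.+1 < k.*2.+3 by rewrite !ltnS ltnW // ltnS leq_double.
pose x : odd_cycle k := Ordinal lt_x; pose y : odd_cycle k := Ordinal lt_y.
(* The successor on the cycle is taken modulo 2k+3; there is no wrap-around because 2j+1 < 2k+3. *)
have xy : adj x y by apply/orP; left; apply/eqP/val_inj; rewrite /= modn_small.
have xN : x \notin cover N by apply/negP => /Ncov; rewrite ltnn.
have yN : y \notin cover N by apply/negP => /Ncov; rewrite ltnNge leqnSn.
have [N'm N'c] := matching_add_edge Nm xy xN yN.
exists ([set x; y] |: N); split; rewrite ?N'c ?Nc //.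
move=> i /bigcupP[e /setU1P[->|eN] ie].
  by move: ie; rewrite !inE doubleS => /orP[] /eqP ->.
have /Ncov lt_i : i \in cover N by apply/bigcupP; exists e.
by rewrite doubleS; do 2!apply: ltnW.
Qed.

Definition is_red c := if c is Red then true else false.
Definition is_blue c := if c is Blue then true else false.
Definition reds (G : cgraph) := [set v : G | is_red (coloring v)].
Definition blues (G : cgraph) := [set v : G | is_blue (coloring v)].

(** The invariant of the construction: all that the theorem needs to know about G. The cycle
    survives only through its odd number of blue vertices and its share b of the matching. *)
Definition certified (G : cgraph) := exists b, [/\ #|blues G| = b.*2.+1,
  forall x y : G, adj x y -> coloring x = Black -> coloring y = Red &
  exists2 N : {set {set G}}, is_matching N & #|N| = b + #|reds G|].

Lemma card_reds_add_leaf (G : cgraph) (u : G) c :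
  #|reds (add_colored_leaf u c)| = is_red c + #|reds G|.
Proof. exact: card_option_pred. Qed.

Lemma card_blues_add_leaf (G : cgraph) (u : G) c :
  #|blues (add_colored_leaf u c)| = is_blue c + #|blues G|.
Proof. exact: card_option_pred. Qed.

Lemma certified_cycle k : certified (@CGraph (odd_cycle k) (fun=> Blue)).
Proof.
exists k.+1; split=> //.
  by rewrite cardsE /= -[RHS](card_ord k.*2.+3); apply: eq_card.
have [N Nm Nc] := odd_cycle_matching k; exists N => //.
by rewrite Nc /reds /= (_ : [set _ | _] = set0) ?cards0 ?addn0 //; apply/setP=> i; rewrite !inE.
Qed.

(** The edge joining the two new vertices extends the old matching and pays for the new red vertex;
    the new black vertex has only that red neighbour. *)
Lemma certified_path (G : cgraph) (u : G) : certified G ->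
  certified (@add_colored_leaf (add_colored_leaf u Red) None Black).
Proof.
move=> [b [Gb blackG [N Nm Nc]]]; exists b; split.
- by rewrite !card_blues_add_leaf.
- case=> [[x|]|] [[y|]|] //=; first exact: blackG.
pose f (x : G) : @add_leaf (add_colored_leaf u Red) None := Some (Some x).
have f_inj : injective f by move=> x y [].
have fN : is_matching (image_matching f N) by apply: is_matching_image.
pose u1 : @add_leaf (add_colored_leaf u Red) None := Some None.
pose u2 : @add_leaf (add_colored_leaf u Red) None := None.
have u1N : u1 \notin cover (image_matching f N).
  by apply/negP => /cover_image_matching[].
have u2N : u2 \notin cover (image_matching f N).
  by apply/negP => /cover_image_matching[].
have u12 : adj u1 u2 by [].
have [N'm N'c] := matching_add_edge fN u12 u1N u2N.
exists ([set u1; u2] |: image_matching f N) => //.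
by rewrite N'c card_image_matching // Nc !card_reds_add_leaf addnS.
Qed.

(** The old matching still has the right size, as no red vertex is added; [u] being red preserves
    the condition on black vertices. *)
Lemma certified_leaf (G : cgraph) (u : G) :
  coloring u = Red -> certified G -> certified (add_colored_leaf u Black).
Proof.
move=> u_red [b [Gb blackG [N Nm Nc]]]; exists b; split.
- by rewrite card_blues_add_leaf.
- case=> [x|] [y|] //=; first exact: blackG.
  + by move=> /eqP->; rewrite u_red.
  + by move=> /eqP->.
pose f (x : G) : add_leaf u := Some x.
have f_inj : injective f by move=> x y [].
exists (image_matching f N); first exact: is_matching_image.
by rewrite card_image_matching // Nc card_reds_add_leaf.
Qed.

Lemma certified_iso (G H : cgraph) :
  cgraph_iso G H -> certified G -> certified H.
Proof.
move=> [f [f_bij f_adj f_col]] [b [Gb blackG [N Nm Nc]]].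
have f_inj := bij_inj f_bij.
have card_class (p : pred color) :
    #|[set v : H | p (coloring v)]| = #|[set v : G | p (coloring v)]|.
  rewrite -(on_card_preimset (onW_bij _ f_bij)).
  by apply: eq_card => x; rewrite !inE f_col.
exists b; split.
- by rewrite [LHS]card_class.
- have [g fK gK] := f_bij => x y.
  by rewrite -(gK x) -(gK y) f_adj !f_col; apply: blackG.
exists (image_matching f N).
  by apply: is_matching_image => // x y; rewrite f_adj.
by rewrite card_image_matching // Nc [#|reds H|]card_class.
Qed.

Lemma constructed_certified (G : cgraph) : constructed G -> certified G.
Proof.
elim=> {G} [k|G u _ IH|G u _ IH u_red|G H _ IH GH].
- exact: certified_cycle.
- exact: certified_path.
- exact: certified_leaf.
- exact: certified_iso IH.
Qed.

(** Disjoint edges with two vertices each give 2|M| <= 2b+1, and parity gains the last half. *)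
Lemma leq_card_matching_within (G : sgraph) (M : {set {set G}}) (A : {set G}) b :
  is_matching M -> cover M \subset A -> #|A| = b.*2.+1 -> #|M| <= b.
Proof.
move=> [/subsetP sM tM] /subset_leq_card + cA.
rewrite cA -(eqP tM) (eq_bigr (fun=> 2)) => [|e /sM/edgesP[x [y [xy ->]]]].
  by rewrite sum_nat_const muln2 => le2; rewrite -ltnS -ltn_double doubleS ltnS.
by rewrite cards2 (adj_neq xy).
Qed.

Lemma is_matching_sub (G : sgraph) (M N : {set {set G}}) :
  N \subset M -> is_matching M -> is_matching N.
Proof.
by move=> sNM [sM tM]; split; [apply: subset_trans sM | apply: trivIsetS tM].
Qed.

Theorem theorem4p4 (G : cgraph) :
  constructed G ->
  forall M : {set {set G}}, maximum_matching M ->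
  forall v : G, coloring v = Red -> covers M v.
Proof.
move=> /constructed_certified[b [cb blackG [N Nm Nc]]] M [Mm Mmax] v v_red.
suff: v \in cover M by case/bigcupP=> e eM ve; exists e.
(* If [v] is uncovered, maximality is contradicted by |M| < b + r, with r the number of red
   vertices. *)
apply: contraT => vM; have := Mmax N Nm; rewrite Nc leqNgt => /negP[].
pose B := [set e in M | [disjoint e & reds G]].
have sBM : B \subset M by apply/subsetP => e; rewrite inE => /andP[].
have leB : #|B| <= b.
  apply: leq_card_matching_within (is_matching_sub sBM Mm) _ cb.
  (* Neither endpoint is red, and [x] is not black, for otherwise [y] would be red. *)
  have blue_edge x y : adj x y -> [disjoint [set x; y] & reds G] -> x \in blues G.
    move=> xy dxy; have red0 z : z \in [set x; y] -> ~~ is_red (coloring z).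
      by move=> /(disjointFr dxy); rewrite inE => ->.
    have := blackG x y xy; have := red0 x (set21 x y); have := red0 y (set22 x y).
    rewrite inE; case: (coloring x) => //.
    by move=> + _ => /[swap] /(_ erefl) ->.
  apply/bigcupsP => e; rewrite inE => /andP[eM].
  have /edgesP[x [y [xy ->]]] := subsetP Mm.1 e eM => dxy.
  rewrite subUset !sub1set (blue_edge x y) //= (blue_edge y x) //.
    by rewrite adj_sym.
  by rewrite setUC.
(* Each remaining edge has a red endpoint, which differs from [v] because [v] is uncovered. *)
have leR : #|M :\: B| <= #|reds G :\ v|.
  apply: leq_card_trivIset_meet; first exact: trivIsetS (subsetDl _ _) Mm.2.
  move=> e; rewrite !inE => /andP[+ eM]; rewrite eM /=.
  case/pred0Pn => x /andP[/= xe xR]; exists x => //.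
  rewrite in_setD1 xR andbT; apply: contraNneq vM => <-.
  by apply/bigcupP; exists e.
have vR : v \in reds G by rewrite inE v_red.
(* Removing [v] from the red vertices lowers their number by one, which makes the inequality
   strict. *)
rewrite -(cardsID B M) (setIidPr sBM) (cardsD1 v (reds G)) vR addnS ltnS.
exact: leq_add.
Qed.
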